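(* Let $(X,\langle\cdot,\cdot\rangle)$ and $(U,\langle\cdot,\cdot\rangle_U)$ be real Hilbert spaces, let $M:X\supseteq D(M)\to X$ be a (not necessarily linear) m-accretive operator and let $B:U\to X$ be linear and bounded. Consider the maximally monotone port-Hamiltonian system $$\tfrac{\mathrm d}{\mathrm dt}x(t)=-M(x(t))+Bu(t),\quad x(0)=x_0,\qquad y(t)=B^*x(t).$$ Let $(\overline x,\overline u)\in D(M)\times U$ be a steady state pair, i.e. $-M(\overline x)+B\overline u=0$, and set $\overline y=B^*\overline x$. Then for all $t_f>0$, all $u\in W^{1,1}([0,t_f],U)$ and all $x_0\in D(M)$, the strong solution $x$ with output $y=B^*x$ satisfies for almost every $t\in[0,t_f]$ $$\tfrac12\tfrac{\mathrm d}{\mathrm dt}\|x(t)-\overline x\|^2=-\langle x(t)-\overline x,M(x(t))-M(\overline x)\rangle+\langle u(t)-\overline u,y(t)-\overline y\rangle_U\le\langle u(t)-\overline u,y(t)-\overline y\rangle_U .$$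
   Context: An operator $M:X\supseteq D(M)\to X$ on a real Hilbert space is accretive if $\langle M(x_1)-M(x_2),x_1-x_2\rangle\ge0$ for all $x_1,x_2\in D(M)$, and m-accretive if in addition $\operatorname{ran}(\lambda I+M)=X$ for some (equivalently all) $\lambda>0$. A strong solution on $[0,t_f]$ is a function $x\in C([0,t_f],X)\cap W^{1,1}((0,t_f],X)$ that is differentiable almost everywhere, satisfies $x(0)=x_0$ and satisfies the differential equation pointwise for almost every $t\in(0,t_f)$. Known fact: if $M$ is m-accretive, $u\in W^{1,1}([0,t_f],U)$ and $x_0\in D(M)$, there is a unique strong solution, and it lies in $W^{1,\infty}([0,t_f],X)$. *)

(* Defs.v *)
From HB Require Import structures.
From mathcomp Require Import all_boot all_order all_algebra.
From mathcomp Require Import all_classical all_reals all_analysis.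

Set Implicit Arguments.
Unset Strict Implicit.
Unset Printing Implicit Defensive.

Import Order.TTheory GRing.Theory Num.Theory.
Import numFieldNormedType.Exports.

Local Open Scope classical_set_scope.
Local Open Scope ring_scope.

(* Real Hilbert spaces. The form type {dot V for idfun} packs bilinearity,
   symmetry and positive definiteness; normr_inner says that the norm, hence
   the (complete) topology of V, is the one induced by the inner product. *)
HB.mixin Record CompleteNormedModule_isHilbert (R : realType) (V : Type)
    of CompleteNormedModule R V := {
  inner : {dot V for idfun} ;
  normr_inner : forall x : V, `|x| ^+ 2 = inner x x }.

#[short(type="hilbertType")]
HB.structure Definition Hilbert (R : realType) :=
  { V of CompleteNormedModule R V & CompleteNormedModule_isHilbert R V }.

(* The value at x is the w with <B u, x> = <u, w> for all u, which exists (by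
   Riesz) and is unique when B is linear and bounded; 0 is a dummy default. *)
Definition adjoint (R : realType) (U X : hilbertType R) (B : U -> X) (x : X) : U :=
  xget 0 [set w | forall u : U, inner (B u) x = inner u w].

Section Operators.
Context {R : realType} {X : hilbertType R}.

(* A partial operator is given by its domain D and a total function M, whose
   values outside D are never used. *)
Definition accretive (D : set X) (M : X -> X) : Prop :=
  forall x1 x2 : X, D x1 -> D x2 -> 0 <= inner (M x1 - M x2) (x1 - x2).

Definition m_accretive (D : set X) (M : X -> X) : Prop :=
  accretive D M /\
  exists2 lambda : R, 0 < lambda &
    forall z : X, exists2 x : X, D x & lambda *: x + M x = z.

End Operators.

(* Bochner integration of vector-valued functions of a real variable. *)
Section Bochner.
Context {R : realType} {V : completeNormedModType R}.
Local Notation mu := (@lebesgue_measure R).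

Record simple_map := SimpleMap {
  simple_size : nat ;
  simple_set : 'I_simple_size -> set (measurableTypeR R) ;
  simple_val : 'I_simple_size -> V ;
  simple_measurable : forall i, measurable (simple_set i) ;
  simple_finite : forall i, (mu (simple_set i) < +oo)%E }.

Definition simple_eval (s : simple_map) (t : R) : V :=
  \sum_(i < simple_size s) \1_(simple_set i) t *: simple_val i.

Definition simple_integral (D : set R) (s : simple_map) : V :=
  \sum_(i < simple_size s) fine (mu (simple_set i `&` D)) *: simple_val i.

Definition bochner_approx (D : set R) (f : R -> V) (s : nat -> simple_map) : Prop :=
  (\forall t \ae mu, D t -> simple_eval (s n) t @[n --> \oo] --> f t) /\
  (\int[mu]_(t in D) (`|f t - simple_eval (s n) t|%R)%:E)%E @[n --> \oo] --> 0%E.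

Definition bochner_integrable (D : set R) (f : R -> V) : Prop :=
  exists s, bochner_approx D f s.

(* The limit exists and does not depend on s when f is integrable over the
   measurable set D; 0 is a dummy default. *)
Definition bochner_integral (D : set R) (f : R -> V) : V :=
  xget 0 [set v | exists2 s, bochner_approx D f s &
                    simple_integral D (s n) @[n --> \oo] --> v].

End Bochner.

Section Sobolev.
Context {R : realType} {V : completeNormedModType R}.

(* phi is in C_c^oo(]a, b[) *)
Definition test_function (a b : R) (phi : R -> R) : Prop :=
  (forall n t, derivable (derive1n n phi) t 1) /\
  exists c d, [/\ a < c, d < b & forall t, phi t != 0 -> c <= t <= d].

Definition weak_derivative (a b : R) (f g : R -> V) : Prop :=
  forall phi, test_function a b phi ->
    bochner_integral `]a, b[ (fun t => derive1 phi t *: f t) =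
    - bochner_integral `]a, b[ (fun t => phi t *: g t).

(* Membership of (the class of) f in W^{1,1}(I, V), for any interval I with end
   points a and b: including the end points or not makes no difference. *)
Definition W11 (a b : R) (f : R -> V) : Prop :=
  bochner_integrable `]a, b[ f /\
  exists2 g, bochner_integrable `]a, b[ g & weak_derivative a b f g.

End Sobolev.

(* x is a strong solution of x' = - M x + B u, x 0 = x0 on [0, tf]. Functions of
   time are total on R, but only their values on [0, tf] matter. *)
Definition strong_solution (R : realType) (X U : hilbertType R)
    (D : set X) (M : X -> X) (B : U -> X) (u : R -> U) (x0 : X) (tf : R)
    (x : R -> X) : Prop :=
  [/\ {within `[0, tf], continuous x},
      W11 0 tf x,
      \forall t \ae (@lebesgue_measure R), 0 < t < tf -> derivable x t 1,
      x 0 = x0 &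
      \forall t \ae (@lebesgue_measure R), 0 < t < tf ->
        D (x t) /\ derive1 x t = - M (x t) + B (u t)].

(* Main.v *)
(** The squared norm is the diagonal of a continuous symmetric bilinear form, so
    at every point where [x] is differentiable
    [1/2 d/dt |x - xbar|^2 = <x - xbar, x'>].  Substituting the equation for [x']
    and the steady state identity [M xbar = B ubar], the term
    [<x - xbar, B (u - ubar)>] becomes [<y - ybar, u - ubar>] by adjointness, and
    accretivity of [M] gives the inequality.  Existence of the adjoint is the Riesz
    representation theorem, obtained by minimising
    [J v = 1/2 |v|^2 - phi v]: minimising sequences are Cauchy by the
    parallelogram law, and a minimiser represents [phi]. *)

Require Import Defs.
From HB Require Import structures.
From mathcomp Require Import all_boot all_order all_algebra.
From mathcomp Require Import all_classical all_reals all_analysis.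
From mathcomp Require Import ring lra.
Import Order.TTheory GRing.Theory Num.Theory.
Import numFieldNormedType.Exports.
Local Open Scope classical_set_scope.
Local Open Scope ring_scope.

Section HilbertSpace.
Context {R : realType} {V : hilbertType R}.
Implicit Types (a b v w : V) (phi : {scalar V}).

Lemma innerC a b : inner a b = inner b a.
Proof. by rewrite hermC expr0 mul1r. Qed.

Lemma innerDl a b v : inner (a + b) v = inner a v + inner b v.
Proof. exact: linearDl. Qed.

Lemma innerBl a b v : inner (a - b) v = inner a v - inner b v.
Proof. exact: linearBl. Qed.

Lemma innerZl (k : R) a b : inner (k *: a) b = k * inner a b.
Proof. exact: linearZl_LR. Qed.

Lemma innerDr a b v : inner v (a + b) = inner v a + inner v b.
Proof. exact: linearDr. Qed.

Lemma innerBr a b v : inner v (a - b) = inner v a - inner v b.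
Proof. exact: linearBr. Qed.

Lemma innerZr (k : R) a b : inner a (k *: b) = k * inner a b.
Proof. by rewrite innerC innerZl innerC. Qed.

Lemma sqr_normD a b : `|a + b| ^+ 2 = `|a| ^+ 2 + inner a b *+ 2 + `|b| ^+ 2.
Proof. by rewrite !normr_inner innerDl !innerDr (innerC b a); ring. Qed.

Lemma sqr_normB a b : `|a - b| ^+ 2 = `|a| ^+ 2 - inner a b *+ 2 + `|b| ^+ 2.
Proof. by rewrite !normr_inner innerBl !innerBr (innerC b a); ring. Qed.

(** Polarization reduces the continuity of [inner] to that of the norm. *)
Lemma inner_polar a b : inner a b = 4^-1 * (`|a + b| ^+ 2 - `|a - b| ^+ 2).
Proof. by rewrite sqr_normD sqr_normB; field. Qed.

Lemma sub_sqr_norm a b : `|a| ^+ 2 - `|b| ^+ 2 = inner (a - b) (a + b).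
Proof. by rewrite !normr_inner innerBl !innerDr (innerC b a); ring. Qed.

Lemma cauchy_schwarz a b : `|inner a b| <= `|a| * `|b|.
Proof.
rewrite -(@ler_pXn2r _ 2) ?nnegrE ?mulr_ge0// real_normK ?num_real// exprMn.
have [->|b0] := eqVneq b 0; first by rewrite inner_polar addr0 subr0 subrr mulr0
  expr0n/= normr0 expr0n mulr0.
have nb0 : 0 < `|b| ^+ 2 by rewrite exprn_gt0// normr_gt0.
(* This vector is [|b| ^+ 2] times the component of [a] orthogonal to [b]; its squared norm factors
   as [n * (m * n - p ^+ 2)]. *)
have := sqr_ge0 (`| `|b| ^+ 2 *: a - inner a b *: b|).
rewrite sqr_normB !normrZ innerZl innerZr !exprMn !real_normK ?num_real//.
set n := `|b| ^+ 2 in nb0 *; set m := `|a| ^+ 2; set p := inner a b => h.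
have : 0 <= n * (m * n - p ^+ 2) by move: h; congr (_ <= _); ring.
by rewrite pmulr_rge0// subr_ge0.
Qed.

Lemma cvg_inner (T : Type) (F : set_system T) (FF : Filter F) (f g : T -> V) a b :
  f x @[x --> F] --> a -> g x @[x --> F] --> b ->
  inner (f x) (g x) @[x --> F] --> inner a b.
Proof.
move=> fa gb; rewrite inner_polar.
under eq_fun do rewrite inner_polar.
have cvg_sqr (h : T -> V) v : h x @[x --> F] --> v ->
    `|h x| ^+ 2 @[x --> F] --> `|v| ^+ 2.
  by move=> hv; exact: cvgM (cvg_norm hv) (cvg_norm hv).
apply: cvgM; first exact: cvg_cst.
by apply: cvgB; apply: cvg_sqr; [exact: cvgD | exact: cvgB].
Qed.

(** By [sub_sqr_norm] the difference quotient is the inner product of the quotient of [f] with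
    [f (t + h) + f t], and both factors converge. *)
Lemma is_derive_sqr_norm (f : R -> V) (t : R) :
  derivable f t 1 ->
  is_derive t 1 (fun s => `|f s| ^+ 2) (2 * inner (f t) (f^`()%classic t)).
Proof.
move=> df.
have fc : f (h *: 1 + t) @[h --> (0 : R)^'] --> f t.
  have cf : {for t, continuous f}.
    exact/differentiable_continuous/derivable1_diffP.
  have ht : h *: 1 + t @[h --> (0 : R)^'] --> t.
    apply: cvg_trans (_ : h *: 1 + t @[h --> (0 : R)] --> t).
      by apply: cvg_app; exact: cvg_within.
    rewrite -[X in _ --> X](add0r t) -[X in _ --> X + t](scale0r (1 : R)).
    by apply: cvgD; [apply: cvgZ => //; exact: cvg_cst | exact: cvg_cst].
  exact: cvg_comp ht cf.
have dq : h^-1 *: ((fun s => `|f s| ^+ 2) (h *: 1 + t) - `|f t| ^+ 2)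
    @[h --> (0 : R)^'] --> 2 * inner (f t) (f^`()%classic t).
  have -> : 2 * inner (f t) (f^`()%classic t) = inner (f^`()%classic t) (f t + f t).
    by rewrite innerDr (innerC (f t)); ring.
  have quot h : h^-1 *: (`|f (h *: 1 + t)| ^+ 2 - `|f t| ^+ 2) =
      inner (h^-1 *: (f (h *: 1 + t) - f t)) (f (h *: 1 + t) + f t).
    by rewrite sub_sqr_norm innerZl.
  rewrite (eq_cvg _ _ quot); apply: cvg_inner; first by rewrite derive1E; exact: df.
  by apply: cvgD => //; exact: cvg_cst.
by apply: DeriveDef; [apply/cvg_ex; exists (2 * inner (f t) (f^`()%classic t))
  | exact: cvg_lim dq].
Qed.

Lemma riesz phi (c : R) : (forall v, `|phi v| <= c * `|v|) ->
  exists w, forall v, phi v = inner v w.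
Proof.
move=> phic.
pose J v := 2^-1 * `|v| ^+ 2 - phi v.
(* Bound [phi v] by [c * |v|] and complete the square. *)
have J_ge v : - (2^-1 * c ^+ 2) <= J v.
  have := le_trans (ler_norm _) (phic v); have := sqr_ge0 (`|v| - c).
  by rewrite /J; nra.
have infJ : has_inf (range J).
  split; first by exists (J 0), 0.
  by exists (- (2^-1 * c ^+ 2)) => _ [v _ <-].
pose m := inf (range J).
have m_le v : m <= J v by apply: ge_inf; [case: infJ | exists v].
have /choice[w Jw] n : exists v, J v < m + harmonic n.
  have h0 : 0 < harmonic n :> R by rewrite /= invr_gt0.
  by have [_ [v _ <-]] := inf_adherent h0 infJ; exists v.
(* The midpoint [z] of [a] and [b] satisfies [J a + J b - 2 * J z = |a - b| ^+ 2 / 4], and [J z] is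
   at least [m]. *)
have parallelogram a b : `|a - b| ^+ 2 <= 4 * ((J a - m) + (J b - m)).
  have := m_le (2^-1 *: (a + b)).
  rewrite /J normrZ linearZ linearD /= exprMn ger0_norm ?invr_ge0//.
  by rewrite sqr_normB sqr_normD; lra.
have /cauchy_cvgP wcvg : cauchy (w n @[n --> \oo]).
  apply/cauchyP => e e0.
  (* Two excesses over [m], each below [e ^+ 2 / 8], give a squared distance below [e ^+ 2]. *)
  have [N _ hN] : \forall n \near \oo, (harmonic n : R) < e ^+ 2 / 8.
    exact: (cvgr_lt _ cvg_harmonic _ (divr_gt0 (exprn_gt0 _ e0) _)).
  exists (w N), N => // n /= Nn; rewrite -ball_normE /=.
  rewrite -(@ltr_pXn2r _ 2) ?nnegrE ?(ltW e0)//.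
  have := parallelogram (w N) (w n); have := Jw N; have := Jw n.
  by have := hN N (leqnn N); have := hN n Nn; lra.
exists (lim (w n @[n --> \oo])) => v.
set l := lim _; set a := phi v - inner v l.
(* The quadratic is [J (l + t *: v) - J l]. Its sign is the limit of [J (w n) - harmonic n < m <= J
   (w n + t *: v)]. *)
have aE (t : R) : 0 <= 2^-1 * `|v| ^+ 2 * t ^+ 2 - t * a.
  rewrite -[leRHS]addr0.
  pose f n : R := 2^-1 * `|v| ^+ 2 * t ^+ 2 - t * (phi v - inner v (w n)) + harmonic n.
  have fc : f n @[n --> \oo] --> 2^-1 * `|v| ^+ 2 * t ^+ 2 - t * a + 0.
    apply: cvgD; last exact: cvg_harmonic.
    apply: cvgB; first exact: cvg_cst.
    apply: cvgM; first exact: cvg_cst.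
      apply: cvgB; first exact: cvg_cst.
    by apply: cvg_inner => //; exact: cvg_cst.
  apply: (cvgr_to_ge fc); near=> n.
  have := m_le (w n + t *: v); have := Jw n.
  rewrite /f /J linearD linearZ /= sqr_normD innerZr (innerC v) normrZ exprMn.
  rewrite real_normK ?num_real//; set h := n.+1%:R^-1.
  by move: (inner _ _) (phi v) (`|v|) => p q k; lra.
apply/eqP; rewrite -subr_eq0 -/a -sqrf_eq0 eq_le sqr_ge0 andbT.
have k1 : 0 < `|v| ^+ 2 + 1 by rewrite ltr_wpDl ?sqr_ge0.
(* This [t] makes the quadratic [- a ^+ 2] times a positive factor, which forces [a = 0]; the [+ 1]
   keeps the denominator positive even for [v = 0]. *)
have := aE (a / (`|v| ^+ 2 + 1)); set k := `|v| ^+ 2 in k1 *.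
have -> : 2^-1 * k * (a / (k + 1)) ^+ 2 - a / (k + 1) * a
   = - (a ^+ 2) * ((2^-1 * k + 1) / (k + 1) ^+ 2).
  by field; rewrite gt_eqF.
rewrite pmulr_lge0 ?oppr_ge0// divr_gt0 ?exprn_gt0//.
by have : 0 <= k := sqr_ge0 _; lra.
Unshelve. all: by end_near. Qed.

End HilbertSpace.

(** By Cauchy-Schwarz [v |-> inner (B v) x] is bounded by [c * |x|], so [riesz] provides a
    representative and [xget] does not return its default [0]. *)
Lemma adjointP (R : realType) (U X : hilbertType R) (B : {linear U -> X}) :
  (exists c : R, forall v : U, `|B v| <= c * `|v|) ->
  forall v x, inner (B v) x = inner v (adjoint B x).
Proof.
move=> [c Bc] v x.
have [z|w Bw] := @riesz _ _ (applyr inner x \o B : {scalar U}) (c * `|x|).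
  by rewrite (le_trans (cauchy_schwarz _ _))// mulrAC ler_wpM2r.
have ex : exists w', forall z, inner (B z) x = inner z w' by exists w => z; exact: Bw z.
exact: (xgetPex 0 ex v).
Qed.

Theorem proposition2p3 (R : realType) (X U : hilbertType R)
  (D : set X) (M : X -> X) (hM : m_accretive D M)
  (B : {linear U -> X}) (hB : exists c : R, forall v : U, `|B v| <= c * `|v|)
  (xbar : X) (ubar : U) (hxbar : D xbar) (hsteady : - M xbar + B ubar = 0)
  (tf : R) (htf : 0 < tf) (u : R -> U) (hu : W11 0 tf u)
  (x0 : X) (hx0 : D x0)
  (x : R -> X) (hx : strong_solution D M B u x0 tf x) :
  let y := fun t : R => adjoint B (x t) in
  let ybar := adjoint B xbar in
  \forall t \ae (@lebesgue_measure R), 0 <= t <= tf ->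
    [/\ D (x t),
        derivable (fun s : R => `|x s - xbar| ^+ 2) t 1,
        2^-1 * derive1 (fun s : R => `|x s - xbar| ^+ 2) t =
          - inner (x t - xbar) (M (x t) - M xbar)
          + inner (u t - ubar) (y t - ybar) &
        - inner (x t - xbar) (M (x t) - M xbar)
          + inner (u t - ubar) (y t - ybar)
        <= inner (u t - ubar) (y t - ybar)].
Proof.
move=> y ybar; have [_ _ dx _ eqx] := hx.
have ae_filter : Filter (almost_everywhere (@lebesgue_measure R)).
  exact: ae_filter_ringOfSetsType.
(* The equation is known only for [0 < t < tf], whereas the claim concerns the closed interval; the
   two end points form a null set. *)
have ends a : \forall t \ae (@lebesgue_measure R), t != a.
  exists [set a]; split => //; first exact: lebesgue_measure_set1.
  by move=> t /negP; rewrite negbK => /eqP.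
near=> t => /andP[t0 ttf].
have t0tf : 0 < t < tf.
  by rewrite !lt_neqAle t0 ttf eq_sym !andbT; apply/andP; split; near: t; exact: ends.
have dxt : derivable x t 1 by move: t0tf; near: t.
have [Dxt xt'] : D (x t) /\ derive1 x t = - M (x t) + B (u t) by move: t0tf; near: t.
have dzt : derivable (fun s => x s - xbar) t 1 by exact: derivableB.
have [dsq dsqE] := is_derive_sqr_norm _ _ dzt.
split => //; last first.
  by rewrite gerDr oppr_le0 innerC; case: hM => acc _; exact: acc.
have dzE : derive1 (fun s => x s - xbar) t = B (u t - ubar) - (M (x t) - M xbar).
  rewrite derive1E deriveB// derive_cst subr0 -derive1E xt' linearB/=.
  (* The steady state turns [B ubar] into [M xbar], which cancels the one subtracted from
     [M (x t)]. *)
  rewrite -(addr0_eq hsteady) opprK.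
  by rewrite opprB addrA subrK addrC.
rewrite derive1E dsqE dzE mulrA mulVf ?pnatr_eq0// mul1r.
rewrite [LHS]innerBr [LHS]addrC; congr (_ + _).
(* Adjointness is applied to [x t] and [xbar] separately, so linearity of [adjoint B] does not
   enter. *)
by rewrite innerC innerBr !adjointP// -innerBr.
Unshelve. all: by end_near. Qed.
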